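(* Let $d,n\ge1$, $\sigma>0$, $\psi\ge 1$, let $\mathbf M$ and $\mathbf S$ be symmetric positive definite $d\times d$ matrices, $\mathbf T$ symmetric positive semi-definite, and $W=\{\mathbf w:\mathbf w^\top\mathbf M\mathbf w\le1\}$. For $\mathbf A\in\mathbb R^{d\times d}$ define the estimator $\hat{\mathbf w}_{\mathbf A}=\frac1n\mathbf M^{-1/2}\mathbf A\mathbf M^{1/2}\mathbf S^{-1}\sum_{i=1}^n\mathbf x_iy_i$ and $$J(\mathbf A)=\big\|(\mathbf I-\mathbf A)^\top\mathbf T'(\mathbf I-\mathbf A)\big\|+\frac{2\sigma^2+2\psi\|\mathbf S'\|}{n}\big\langle\mathbf T',\mathbf A(\mathbf S')^{-1}\mathbf A^\top\big\rangle .$$ Then for every $\mathbf A$, $\sup_{(P,Q)\in\mathcal P_\psi(W,\mathbf S,\mathbf T)}\mathbb E\|\hat{\mathbf w}_{\mathbf A}-\mathbf w^*\|_{\mathbf T}^2\le J(\mathbf A)$, where the expectation is over $n$ i.i.d. samples $(\mathbf x_i,y_i)\sim P$. In particular, for $\hat{\mathbf w}^{\mathrm{opt}}=\hat{\mathbf w}_{\mathbf A^\star}$ with $\mathbf A^\star\in\arg\min_{\mathbf A}J(\mathbf A)$, $$\sup_{(P,Q)\in\mathcal P_\psi(W,\mathbf S,\mathbf T)}\mathbb E\|\hat{\mathbf w}^{\mathrm{opt}}-\mathbf w^*\|_{\mathbf T}^2\le\min_{\mathbf A\in\mathbb R^{d\times d}}J(\mathbf A).$$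
   Context: Notation: $\|\mathbf w\|_{\mathbf A}^2=\mathbf w^\top\mathbf A\mathbf w$; $\|\cdot\|$ is the spectral norm; $\langle\mathbf A,\mathbf B\rangle=\operatorname{tr}(\mathbf A^\top\mathbf B)$; $\mathbf S'=\mathbf M^{-1/2}\mathbf S\mathbf M^{-1/2}$, $\mathbf T'=\mathbf M^{-1/2}\mathbf T\mathbf M^{-1/2}$. Class $\mathcal P_\psi(W,\mathbf S,\mathbf T)$: all pairs $(P,Q)$ of probability distributions of $(\mathbf x,y)\in\mathbb R^d\times\mathbb R$ with finite fourth moments such that (i) $\mathbb E_P[\mathbf x\mathbf x^\top]=\mathbf S$, $\mathbb E_Q[\mathbf x\mathbf x^\top]=\mathbf T$; (ii) the source risk $\frac12\mathbb E_P(y-\langle\mathbf w,\mathbf x\rangle)^2$ and target risk $\frac12\mathbb E_Q(y-\langle\mathbf w,\mathbf x\rangle)^2$ admit a common minimizer $\mathbf w^*\in W$; (iii) with $\epsilon=y-\mathbf x^\top\mathbf w^*$, $\mathbb E_P[\epsilon^2\mathbf x\mathbf x^\top]\preceq\sigma^2\mathbf S$; (iv) (fourth moment) for every positive semi-definite $\mathbf A$, $\mathbb E_P[\mathbf x\mathbf x^\top\mathbf A\mathbf x\mathbf x^\top]\preceq\psi\operatorname{tr}(\mathbf S\mathbf A)\mathbf S$. *)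

(* Defs.v *)
From HB Require Import structures.
From mathcomp Require Import all_boot all_order all_algebra.
From mathcomp Require Import all_classical all_reals all_analysis.

Set Implicit Arguments.
Unset Strict Implicit.
Unset Printing Implicit Defensive.

Import Order.TTheory GRing.Theory Num.Theory.
Import numFieldNormedType.Exports.

Local Open Scope classical_set_scope.
Local Open Scope ring_scope.

Section LinAlg.
Context {R : realType} {d : nat}.

Definition qform (A : 'M[R]_d) (v : 'cV[R]_d) : R := (v^T *m A *m v) 0 0.

Definition symmx (A : 'M[R]_d) : Prop := A^T = A.
Definition psdmx (A : 'M[R]_d) : Prop := forall v : 'cV[R]_d, 0 <= qform A v.
Definition pdmx (A : 'M[R]_d) : Prop :=
  forall v : 'cV[R]_d, v != 0 -> 0 < qform A v.

Definition loewner_le (A B : 'M[R]_d) : Prop := psdmx (B - A).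

Definition sqrtmx (A : 'M[R]_d) : 'M[R]_d :=
  xget 0 [set B | symmx B /\ psdmx B /\ B *m B = A].

Definition isqrtmx (A : 'M[R]_d) : 'M[R]_d := invmx (sqrtmx A).

Definition specnorm (A : 'M[R]_d) : R :=
  sup [set Num.sqrt (\sum_i ((A *m v) i 0) ^+ 2) |
        v in [set v : 'cV[R]_d | \sum_i (v i 0) ^+ 2 = 1]].

Definition frob (A B : 'M[R]_d) : R := \tr (A^T *m B).

Definition primemx (M X : 'M[R]_d) : 'M[R]_d := isqrtmx M *m X *m isqrtmx M.

Definition west (n : nat) (M S A : 'M[R]_d) (X : 'I_n -> 'cV[R]_d)
    (Y : 'I_n -> R) : 'cV[R]_d :=
  n%:R^-1 *: (isqrtmx M *m A *m sqrtmx M *m invmx S *m \sum_(i < n) (Y i *: X i)).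

Definition Jfun (n : nat) (sigma psi : R) (M S T A : 'M[R]_d) : R :=
  specnorm ((1%:M - A)^T *m primemx M T *m (1%:M - A))
  + (2 * sigma ^+ 2 + 2 * psi * specnorm (primemx M S)) / n%:R
    * frob (primemx M T) (A *m invmx (primemx M S) *m A^T).

End LinAlg.

Section Prob.
Context {R : realType} {d : nat}.

(* A distribution of (x, y) in R^d x R is represented as the law of
   (xf z, yf z) for z drawn from a probability measure P on a measurable
   space D (every distribution is of this form). *)

Definition mexpect {dD} {D : measurableType dD} (P : probability D R) {m k : nat}
    (F : D -> 'M[R]_(m, k)) : 'M[R]_(m, k) :=
  \matrix_(i, j) Rintegral P setT (fun z => F z i j).

Definition finite_fourth_moment {dD} {D : measurableType dD} (P : probability D R)
    (xf : D -> 'cV[R]_d) (yf : D -> R) : Prop :=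
  (forall k, measurable_fun setT (fun z => xf z k 0)) /\
  measurable_fun setT yf /\
  (\int[P]_z (((\sum_k (xf z k 0) ^+ 2 + (yf z) ^+ 2) ^+ 2)%:E) < +oo)%E.

Definition risk {dD} {D : measurableType dD} (P : probability D R)
    (xf : D -> 'cV[R]_d) (yf : D -> R) (w : 'cV[R]_d) : \bar R :=
  (\int[P]_z (((yf z - (w^T *m xf z) 0 0) ^+ 2 / 2)%:E))%E.

(* membership of (P, Q) in P_psi(W, S, T), with common minimizer wstar,
   W = {w | w^T M w <= 1} *)
Definition in_class (sigma psi : R) (M S T : 'M[R]_d) (wstar : 'cV[R]_d)
    {dP} {DP : measurableType dP} (P : probability DP R)
    (xP : DP -> 'cV[R]_d) (yP : DP -> R)
    {dQ} {DQ : measurableType dQ} (Q : probability DQ R)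
    (xQ : DQ -> 'cV[R]_d) (yQ : DQ -> R) : Prop :=
  [/\ finite_fourth_moment P xP yP /\ finite_fourth_moment Q xQ yQ,
      mexpect P (fun z => xP z *m (xP z)^T) = S /\
      mexpect Q (fun z => xQ z *m (xQ z)^T) = T,
      [/\ qform M wstar <= 1,
          forall w, (risk P xP yP wstar <= risk P xP yP w)%E &
          forall w, (risk Q xQ yQ wstar <= risk Q xQ yQ w)%E],
      loewner_le
        (mexpect P (fun z => (yP z - (wstar^T *m xP z) 0 0) ^+ 2 *:
                              (xP z *m (xP z)^T)))
        (sigma ^+ 2 *: S) &
      forall A : 'M[R]_d, symmx A -> psdmx A ->
        loewner_le
          (mexpect P (fun z => xP z *m (xP z)^T *m A *m xP z *m (xP z)^T))
          ((psi * \tr (S *m A)) *: S)].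

Definition iid_sample {dO} {Om : measurableType dO} (Pr : probability Om R)
    {dD} {D : measurableType dD} (P : probability D R) (n : nat)
    (Z : 'I_n -> Om -> D) : Prop :=
  [/\ forall i, measurable_fun setT (Z i),
      forall i (B : set D), measurable B -> Pr (Z i @^-1` B) = P B &
      forall B : 'I_n -> set D, (forall i, measurable (B i)) ->
        Pr (\bigcap_(i in setT) (Z i @^-1` B i)) =
        (\prod_(i < n) Pr (Z i @^-1` B i))%E].

Definition worst_risk (n : nat) (sigma psi : R) (M S T A : 'M[R]_d) : \bar R :=
  ereal_sup [set e : \bar R |
    exists (dP dQ dO : measure_display)
      (DP : measurableType dP) (DQ : measurableType dQ)
      (Om : measurableType dO)
      (P : probability DP R) (xP : DP -> 'cV[R]_d) (yP : DP -> R)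
      (Q : probability DQ R) (xQ : DQ -> 'cV[R]_d) (yQ : DQ -> R)
      (wstar : 'cV[R]_d) (Pr : probability Om R) (Z : 'I_n -> Om -> DP),
      [/\ in_class sigma psi M S T wstar P xP yP Q xQ yQ,
          iid_sample Pr P Z &
          e = (\int[Pr]_om
                 (qform T (west M S A (fun i => xP (Z i om))
                                      (fun i => yP (Z i om)) - wstar))%:E)%E]].

End Prob.

(* Main.v *)
Require Import Defs.
From HB Require Import structures.
From mathcomp Require Import all_boot all_order all_algebra.
From mathcomp Require Import all_classical all_reals all_analysis.
From mathcomp Require Import measurable_realfun complex spectral sesquilinear.
From mathcomp Require Import ring lra.
Import Order.TTheory GRing.Theory Num.Theory.
Local Open Scope classical_set_scope.
Local Open Scope ring_scope.

Set Implicit Arguments.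
Unset Strict Implicit.
Unset Printing Implicit Defensive.

(* Let [B = M^(-1/2) A M^(1/2) S^(-1)], so that the estimator is the sample mean
   of [B x y].  First-order optimality of [w*] gives [E(x y) = S w*], hence by
   independence the risk is the bias [||B S w* - w*||_T^2] plus [1/n] times the
   variance of [B x y], and the variance is at most [E ||B x y||_T^2].  With
   [u = M^(1/2) w*], a vector of norm at most 1, the bias is the quadratic form
   of [(I - A)^T T' (I - A)] at [u].  As [x y = x x^T w* + eps x], the second
   moment is at most twice a signal term, controlled by the fourth moment
   condition applied to [B^T T B] and by [w*^T S w* = u^T S' u <= ||S'||], plus
   twice a noise term, controlled by [E(eps^2 x x^T) <= sigma^2 S]; both
   produce [tr(S B^T T B) = <T', A S'^(-1) A^T>]. *)

(** * Square roots of positive semi-definite matrices, by polynomial calculus on the spectrum *)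

Lemma poly_interpolation (F : fieldType) (f : F -> F) (s : seq F) :
  exists q : {poly F}, {in s, forall x, q.[x] = f x}.
Proof.
elim: s => [|a s [q qE]]; first by exists 0.
have [as_|as_] := boolP (a \in s).
  by exists q => x; rewrite inE => /orP[/eqP->|]; exact: qE.
(* Newton's correction: [w] vanishes on [s] but not at [a], so a multiple of it repairs the value at
   [a] and leaves the earlier ones alone. *)
pose w := \prod_(b <- s) ('X - b%:P).
have wa : w.[a] != 0.
  by rewrite -rootE root_prod_XsubC.
exists (q + ((f a - q.[a]) / w.[a]) *: w) => x; rewrite inE hornerD hornerZ.
move=> /orP[/eqP->|xs]; first by rewrite divfK// addrC subrK.
have /eqP-> : w.[x] == 0 by rewrite -rootE root_prod_XsubC.
by rewrite mulr0 addr0 qE.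
Qed.

Section SquareRoot.
Context {R : realType} {d : nat}.
Implicit Types (A B M : 'M[R]_d) (v : 'cV[R]_d).

Lemma qformE A v : qform A v = \sum_i \sum_j A i j * (v i 0 * v j 0).
Proof.
rewrite /qform mxE exchange_big /=; apply: eq_bigr => j _.
rewrite mxE big_distrl /=; apply: eq_bigr => i _; rewrite mxE; ring.
Qed.

Lemma qformZ A (c : R) v : qform A (c *: v) = c ^+ 2 * qform A v.
Proof.
rewrite !qformE mulr_sumr; apply: eq_bigr => i _; rewrite mulr_sumr.
by apply: eq_bigr => j _; rewrite !mxE; ring.
Qed.

Lemma horner_mx_diag_conj (F : fieldType) k (P : 'M[F]_k.+1) (D : 'rV_k.+1)
    (p : {poly F}) : P \in unitmx ->
  horner_mx (invmx P *m diag_mx D *m P) p =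
  invmx P *m diag_mx (map_mx (horner p) D) *m P.
Proof.
by move=> Pu; rewrite horner_mx_uconjC// horner_mx_diag.
Qed.

(** The complex spectral theorem brought back to the reals: over the complex field [M] is Hermitian,
    hence unitarily diagonalisable with real diagonal. The second clause says that a polynomial of
    [M] depends only on its values on the spectrum. *)
Lemma symmx_spectrum k (M : 'M[R]_k.+1) : symmx M ->
  exists2 s : seq R, {in s, forall a, eigenvalue M a} &
    forall p : {poly R}, {in s, forall a, p.[a] = 0} -> horner_mx M p = 0.
Proof.
move=> Msym.
pose cm := map_mx (real_complex R) : 'M[R]_k.+1 -> 'M[complex R]_k.+1.
have Mreal : cm M \is a mxOver Num.real.
  by apply/mxOverP => i j; rewrite mxE; apply/complex_realP; exists (M i j).
have Mherm : cm M \is hermsymmx.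
  apply: realsym_hermsym => //; apply/is_hermitianmxP.
  by rewrite expr0 scale1r map_mx_id// /cm map_trmx Msym.
have /orthomx_spectralP := hermitian_normalmx Mherm.
have Dreal := hermitian_spectral_diag_real Mherm.
move: (spectral_unit (cm M)) Dreal.
set P := spectralmx _; set D := spectral_diag _ => Pu Dreal ME.
pose l j : R := complex.Re (D 0 j).
have Dl j : D 0 j = real_complex R (l j).
  by have /mxOverP/(_ 0 j)/complex_realP[a Da] := Dreal; rewrite /l Da.
exists [seq l j | j <- enum 'I_k.+1] => [a /mapP[j _ ->]|p p0].
  (* Being an eigenvalue is a root condition on the characteristic polynomial, so it can be checked
     over the complex field, where row [j] of [P] is an eigenvector. *)
  rewrite eigenvalue_root_char -(fmorph_root (real_complex R)) map_char_poly.
  rewrite -/(cm M) -eigenvalue_root_char/= -Dl; apply/eigenvalueP.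
  exists (row j P).
    by rewrite {1}ME rowE !mulmxA mulmxK// -[_ *m diag_mx D]rowE row_diag_mx -scalemxAl.
  (* An invertible matrix has no zero row: entry [(j, j)] of [P *m Q] would be 0 instead of 1. *)
  apply: contraTneq Pu => rP0; rewrite -row_free_unit.
  apply/row_freeP => -[Q /matrixP/(_ j j)].
  rewrite !mxE eqxx big1 => [/eqP|i _]; first by rewrite eq_sym oner_eq0.
  by move/rowP: rP0 => /(_ i); rewrite !mxE => ->; rewrite mul0r.
apply: (map_mx_inj (f := real_complex R)).
rewrite map_mx0 map_horner_mx -/(cm M) ME horner_mx_diag_conj//.
suff -> : map_mx (horner (map_poly (real_complex R) p)) D = 0.
  by rewrite linear0 mulmx0 mul0mx.
apply/matrixP => i j; rewrite !mxE ord1 Dl horner_map/= p0 ?rmorph0//.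
by apply: map_f; rewrite mem_enum.
Qed.

(** At a left eigenvector the quadratic form is [a] times the positive squared norm. *)
Lemma psdmx_eigenvalue_ge0 k (M : 'M[R]_k) a :
  psdmx M -> eigenvalue M a -> 0 <= a.
Proof.
move=> Mp /eigenvalueP[v vM v0].
have := Mp v^T; rewrite /qform trmxK vM -scalemxAl mxE.
have vv : 0 < (v *m v^T) 0 0.
  rewrite mxE; have : exists i, v 0 i != 0.
    apply/existsP; apply: contraNT v0; rewrite negb_exists => /forallP v0.
    by apply/eqP/rowP => i; rewrite mxE; apply/eqP; have := v0 i; rewrite negbK.
  move=> [i vi]; rewrite (bigD1 i)//= mxE -expr2.
  rewrite ltr_pwDl ?exprn_even_gt0//=.
  by apply: sumr_ge0 => l _; rewrite mxE -expr2 sqr_ge0.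
by rewrite pmulr_lge0.
Qed.

Lemma trmx_horner_mx k (M : 'M[R]_k.+1) (p : {poly R}) :
  (horner_mx M p)^T = horner_mx M^T p.
Proof.
elim/poly_ind: p => [|p c IH]; first by rewrite !rmorph0 trmx0.
rewrite !rmorphD !rmorphM /= !horner_mx_X !horner_mx_C linearD /= tr_scalar_mx.
rewrite -!mulmxE trmx_mul IH; congr (_ + _).
exact/esym/comm_horner_mx.
Qed.

Lemma psdmx_gram A : psdmx (A^T *m A).
Proof.
move=> v; rewrite /qform !mulmxA -trmx_mul -mulmxA mxE.
by apply: sumr_ge0 => i _; rewrite mxE -expr2 sqr_ge0.
Qed.

End SquareRoot.

(* [B = q(M)^2] with [q] interpolating the fourth root on the spectrum: being a
   square of a symmetric matrix, [B] is positive. *)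
Lemma psdmx_sqrt_exists (R : realType) d (M : 'M[R]_d) : symmx M -> psdmx M ->
  exists B, symmx B /\ psdmx B /\ B *m B = M.
Proof.
case: d M => [|k] M Ms Mp.
  (* Dimension 0 is separate because matrix polynomials are taken in size [k.+1]. *)
  exists 0; split; [|split].
  - by apply/matrixP => -[].
  - by move=> v; rewrite /qform mulmx0 mul0mx mxE.
  - by apply/matrixP => -[].
have [s sM Mp0] := symmx_spectrum Ms.
have [q qE] := poly_interpolation (fun x => Num.sqrt (Num.sqrt x)) s.
(* The eigenvalues are nonnegative, so [q ^+ 4] agrees with the identity on the spectrum and
   [q(M)^4 = M]. *)
have q4 : horner_mx M (q ^+ 4 - 'X) = 0.
  apply: Mp0 => a sa; rewrite !hornerE qE//.
  have a0 := psdmx_eigenvalue_ge0 Mp (sM _ sa).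
  by rewrite (exprM _ 2 2) !sqr_sqrtr ?sqrtr_ge0// subrr.
have qs : (horner_mx M q)^T = horner_mx M q by rewrite trmx_horner_mx Ms.
exists (horner_mx M q *m horner_mx M q); split; [|split].
- by rewrite /symmx trmx_mul qs.
- by rewrite -{1}qs; exact: psdmx_gram.
- move: q4; rewrite rmorphB/= horner_mx_X rmorphXn/= => /subr0_eq q4.
  by rewrite -[RHS]q4 !mulmxE (exprM _ 2 2) !expr2.
Qed.

(** * Trace positivity, Cauchy-Schwarz and bounds by the spectral norm *)

Section MatrixInequalities.
Context {R : realType} {d : nat}.
Implicit Types (A B M N : 'M[R]_d) (v : 'cV[R]_d).

(** Existence of a root ensures that the choice operator in [sqrtmx] does not fall back on its
    default 0. *)
Lemma sqrtmxP M : symmx M -> psdmx M ->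
  [/\ symmx (sqrtmx M), psdmx (sqrtmx M) & sqrtmx M *m sqrtmx M = M].
Proof.
move=> Ms Mp; have [B BP] := psdmx_sqrt_exists Ms Mp.
have := @xgetPex _ 0 [set B | symmx B /\ psdmx B /\ B *m B = M].
by move=> /(_ (ex_intro _ B BP))[? [? ?]].
Qed.

Lemma pdmx_unit M : pdmx M -> M \in unitmx.
Proof.
move=> Mp; rewrite -row_free_unit -kermx_eq0; apply/negPn/negP.
move=> /rowV0Pn[v /sub_kermxP vM v0].
have := Mp v^T; rewrite trmx_eq0 => /(_ v0).
by rewrite /qform trmxK vM mul0mx mxE ltxx.
Qed.

Lemma pdmx_psd M : pdmx M -> psdmx M.
Proof.
move=> Mp v; have [->|v0] := eqVneq v 0; last exact/ltW/Mp.
by rewrite /qform mulmx0 mxE.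
Qed.

Lemma sqrtmx_unit M : symmx M -> pdmx M -> sqrtmx M \in unitmx.
Proof.
move=> Ms Mp; have [_ _ MM] := sqrtmxP Ms (pdmx_psd Mp).
by have := pdmx_unit Mp; rewrite -{1}MM unitmx_mul => /andP[].
Qed.

(** With [A = C *m C], cyclicity gives the trace of [C *m B *m C], whose diagonal entries are values
    of the form of [B] at the columns of [C]. *)
Lemma mxtrace_psdM A B : symmx A -> psdmx A -> psdmx B -> 0 <= \tr (A *m B).
Proof.
move=> As Ap Bp; have [Cs _ <-] := sqrtmxP As Ap; set C := sqrtmx A.
rewrite -mulmxA mxtrace_mulC; apply: sumr_ge0 => i _.
have -> : (C *m B *m C) i i = qform B (col i C); last exact: Bp.
rewrite /qform tr_col Cs -row_mul !mxE.
by apply: eq_bigr => j _; rewrite !mxE.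
Qed.

Lemma qform_sqrtmx M v : symmx M -> psdmx M ->
  qform M v = \sum_i ((sqrtmx M *m v) i 0) ^+ 2.
Proof.
move=> Ms Mp; have [Cs _ MM] := sqrtmxP Ms Mp.
rewrite /qform -{1}MM -{1}Cs !mulmxA -trmx_mul -mulmxA mxE.
by apply: eq_bigr => i _; rewrite mxE expr2.
Qed.

Lemma CauchySchwarz_sum (a b : 'I_d -> R) :
  (\sum_i a i * b i) ^+ 2 <= (\sum_i a i ^+ 2) * (\sum_i b i ^+ 2).
Proof.
set p := \sum_i a i * b i; set q := \sum_i b i ^+ 2; set r := \sum_i a i ^+ 2.
have H t : 0 <= r - 2 * t * p + t ^+ 2 * q.
  have -> : r - 2 * t * p + t ^+ 2 * q = \sum_i (a i - t * b i) ^+ 2.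
    rewrite /r /p /q !mulr_sumr -sumrB -big_split/=.
    by apply: eq_bigr => i _; ring.
  by apply: sumr_ge0 => i _; exact: sqr_ge0.
have [q0|q0] := eqVneq q 0.
  have [->|p0] := eqVneq p 0; first by rewrite expr0n q0 mulr0.
  (* For [q = 0] the polynomial is affine in [t]; at this point it would equal -1. *)
  have := H ((r + 1) / (2 * p)); rewrite q0 mulr0 addr0.
  have -> : 2 * ((r + 1) / (2 * p)) * p = r + 1 by field.
  by rewrite opprD addrA subrr sub0r oppr_ge0 ler10.
have q_gt0 : 0 < q by rewrite lt0r q0 sumr_ge0// => i _; exact: sqr_ge0.
(* The minimizer of the quadratic polynomial in [t]. *)
have := H (p / q).
have -> : r - 2 * (p / q) * p + (p / q) ^+ 2 * q = r - p ^+ 2 / q by field.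
by rewrite subr_ge0 ler_pdivrMr.
Qed.

(** The supremum dominates its members only once the set is known to be bounded; Cauchy-Schwarz on
    each row bounds it by the Frobenius norm. *)
Lemma specnorm_ubound N v : \sum_i (v i 0) ^+ 2 = 1 ->
  Num.sqrt (\sum_i ((N *m v) i 0) ^+ 2) <= specnorm N.
Proof.
move=> v1; apply: ub_le_sup; last by exists v.
exists (Num.sqrt (\sum_i \sum_j (N i j) ^+ 2)) => _ [w /= w1 <-].
rewrite ler_sqrt; last by apply: sumr_ge0 => i _; apply: sumr_ge0 => j _; exact: sqr_ge0.
apply: ler_sum => i _; rewrite mxE.
by apply: le_trans (CauchySchwarz_sum _ _) _; rewrite w1 mulr1.
Qed.

Lemma specnorm_ge0 N : 0 <= specnorm N.
Proof.
have [v1|no] := pselect (exists v : 'cV[R]_d, \sum_i (v i 0) ^+ 2 = 1).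
  case: v1 => v v1; apply: le_trans (specnorm_ubound N v1); exact: sqrtr_ge0.
(* Without unit vectors, as in dimension 0, [specnorm] is the supremum of the empty set, which is
   0. *)
rewrite /specnorm [X in sup X](_ : _ = set0) ?sup0//.
by apply/seteqP; split => // y [v v1 _]; apply: no; exists v.
Qed.

(** For the normalised vector [u], Cauchy-Schwarz bounds the form by the norm of [N *m u]. Scaling
    back multiplies by [s <= 1], which is harmless as the spectral norm is nonnegative. *)
Lemma qform_le_specnorm N v : \sum_i (v i 0) ^+ 2 <= 1 -> qform N v <= specnorm N.
Proof.
move=> v1; set s := \sum_i _ in v1.
have s0 : 0 <= s by apply: sumr_ge0 => i _; exact: sqr_ge0.
suff H : qform N v <= s * specnorm N.
  by apply: le_trans H _; rewrite ler_piMl// specnorm_ge0.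
have [s_eq0|sn0] := eqVneq s 0.
  rewrite s_eq0 mul0r qformE big1// => i _; rewrite big1// => j _.
  have /eqP : v i 0 ^+ 2 = 0.
    apply/eqP; move/eqP: s_eq0; rewrite psumr_eq0 => [/allP/(_ i)|? _].
      by apply; rewrite mem_index_enum.
    exact: sqr_ge0.
  by rewrite sqrf_eq0 => /eqP->; rewrite mul0r mulr0.
have sgt0 : 0 < s by rewrite lt0r sn0.
pose u := (Num.sqrt s)^-1 *: v.
have r0 : Num.sqrt s != 0 by rewrite sqrtr_eq0 -ltNge.
have rr : Num.sqrt s ^+ 2 = s by rewrite sqr_sqrtr.
have u1 : \sum_i (u i 0) ^+ 2 = 1.
  under eq_bigr do rewrite mxE exprMn exprVn rr.
  by rewrite -mulr_sumr mulVf.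
have -> : qform N v = s * qform N u.
  by rewrite qformZ exprVn rr mulrA mulfV// mul1r.
rewrite ler_pM2l//; apply: le_trans (specnorm_ubound N u1).
rewrite /qform -mulmxA mxE; under eq_bigr do rewrite mxE.
apply: le_trans (ler_norm _) _; rewrite -sqrtr_sqr ler_sqrt; last first.
  by apply: sumr_ge0 => i _; exact: sqr_ge0.
by apply: le_trans (CauchySchwarz_sum _ _) _; rewrite u1 mul1r.
Qed.

End MatrixInequalities.

(** * Integrable and square-integrable real functions under a probability *)

Section SquareIntegrable.
Context {R : realType} {dD : measure_display} {D : measurableType dD}.
Variable P : probability D R.
Implicit Types (f g : D -> R).

Definition intble f := P.-integrable setT (EFin \o f).

Definition sqintble f :=
  measurable_fun setT f /\ intble (fun z => f z ^+ 2).

Lemma intble_cst (c : R) : intble (fun=> c).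
Proof. exact: finite_measure_integrable_cst. Qed.

Lemma intbleD f g : intble f -> intble g -> intble (fun z => f z + g z).
Proof. by move=> fi gi; exact: (integrableD measurableT fi gi). Qed.

Lemma intbleB f g : intble f -> intble g -> intble (fun z => f z - g z).
Proof. by move=> fi gi; exact: (integrableB measurableT fi gi). Qed.

Lemma intbleZ (c : R) f : intble f -> intble (fun z => c * f z).
Proof. by move=> fi; exact: (integrableZl measurableT c fi). Qed.

Lemma intble_sum (I : Type) (s : seq I) (f : I -> D -> R) :
  (forall i, intble (f i)) -> intble (fun z => \sum_(i <- s) f i z).
Proof.
move=> fi; elim: s => [|i s IH].
  by under eq_fun do rewrite big_nil; exact: intble_cst.
by under eq_fun do rewrite big_cons; exact: intbleD.
Qed.

Lemma RintegralT_cst (c : R) : Rintegral P setT (fun=> c) = c.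
Proof. by rewrite Rintegral_cst//= [X in fine X]probability_setT mulr1. Qed.

Lemma RintegralT_sum (I : Type) (s : seq I) (f : I -> D -> R) :
  (forall i, intble (f i)) ->
  Rintegral P setT (fun z => \sum_(i <- s) f i z) =
  \sum_(i <- s) Rintegral P setT (f i).
Proof.
move=> fi; elim: s => [|i s IH].
  by rewrite big_nil; under eq_Rintegral do rewrite big_nil; rewrite RintegralT_cst.
rewrite big_cons -IH -RintegralD//; [|exact: fi|exact: intble_sum].
by under eq_Rintegral do rewrite big_cons.
Qed.

Lemma le_intble f g : measurable_fun setT f ->
  (forall z, `|f z| <= g z) -> intble g -> intble f.
Proof.
move=> mf fg; apply: le_integrable => //; first exact/measurable_EFinP.
move=> z _ /=; rewrite lee_fin; apply: le_trans (fg z) _; exact: ler_norm.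
Qed.

(** The product is dominated by the sum of the squares. *)
Lemma sqintbleM f g : sqintble f -> sqintble g -> intble (fun z => f z * g z).
Proof.
move=> [mf fi] [mg gi].
apply: le_intble (intbleD fi gi); first exact: measurable_funM.
move=> z; rewrite ler_norml; apply/andP; split; nra.
Qed.

Lemma sqintble_cst (c : R) : sqintble (fun=> c).
Proof. by split; [exact: measurable_cst|exact: intble_cst]. Qed.

Lemma sqintbleZ (c : R) f : sqintble f -> sqintble (fun z => c * f z).
Proof.
move=> [mf fi]; split; first exact: measurable_funM.
by under eq_fun do rewrite exprMn; exact: intbleZ.
Qed.

Lemma sqintbleD f g : sqintble f -> sqintble g -> sqintble (fun z => f z + g z).
Proof.
move=> sf sg; have fg := sqintbleM sf sg.
case: sf sg => [mf fi] [mg gi]; split; first exact: measurable_funD.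
under eq_fun do rewrite sqrrD -mulr_natl.
by do 2?apply: intbleD => //; exact: intbleZ.
Qed.

Lemma sqintble_sum (I : Type) (s : seq I) (f : I -> D -> R) :
  (forall i, sqintble (f i)) -> sqintble (fun z => \sum_(i <- s) f i z).
Proof.
move=> fi; elim: s => [|i s IH].
  by under eq_fun do rewrite big_nil; exact: sqintble_cst.
by under eq_fun do rewrite big_cons; exact: sqintbleD.
Qed.

Lemma sqintble_intble f : sqintble f -> intble f.
Proof.
move=> /sqintbleM/(_ (sqintble_cst 1)).
by under eq_fun do rewrite mulr1.
Qed.

End SquareIntegrable.

(** * Change of variables and independence *)

Section Independence.
Context {R : realType} {dO dD : measure_display}.
Context {Om : measurableType dO} {D : measurableType dD}.
Variables (Pr : probability Om R) (P : probability D R).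

Definition has_law (X : Om -> D) :=
  measurable_fun setT X /\
  forall B, measurable B -> Pr (X @^-1` B) = P B.

(** The pushforward of [Pr] by [X] agrees with [P] on measurable sets, so integrals against the two
    coincide. Integrability is transferred first, through the absolute value. *)
Lemma integral_has_law (X : Om -> D) (f : D -> R) :
  has_law X -> intble P f ->
  intble Pr (fun om => f (X om)) /\
  Rintegral Pr setT (fun om => f (X om)) = Rintegral P setT f.
Proof.
move=> [mX XP] fi.
pose X' : {mfun Om >-> D} := HB.pack X (isMeasurableFun.Build _ _ _ _ _ mX).
have mf : measurable_fun setT f.
  by move/integrableP : fi => [/measurable_EFinP].
have PE (g : D -> \bar R) :
    (\int[distribution Pr X']_z g z = \int[P]_z g z)%E.
  by apply: eq_measure_integral => B mB _; exact: XP.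
have fXi : intble Pr (fun om => f (X om)).
  apply/integrableP; split; first by apply/measurable_EFinP; exact: measurableT_comp.
  move/integrableP : fi => [_]; rewrite -PE ge0_integral_distribution//=.
  by apply/measurable_EFinP; exact: measurableT_comp.
split => //; rewrite /Rintegral -PE.
rewrite (@integral_distribution _ _ _ _ _ Pr X')//.
exact/measurable_EFinP.
Qed.

Lemma sqintble_has_law (X : Om -> D) (f : D -> R) :
  has_law X -> sqintble P f -> sqintble Pr (fun om => f (X om)).
Proof.
move=> Xl [mf fi]; split; last exact: (integral_has_law Xl fi).1.
by apply: measurableT_comp => //; exact: Xl.1.
Qed.

(** The law of the pair agrees with the product measure on rectangles, hence everywhere by
    uniqueness; Fubini then factors the integral. Square integrability makes the product
    integrable. *)
Lemma Rintegral_indepM (X Y : Om -> D) (f g : D -> R) :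
  has_law X -> has_law Y ->
  (forall A B, measurable A -> measurable B ->
     Pr (X @^-1` A `&` Y @^-1` B) = (P A * P B)%E) ->
  sqintble P f -> sqintble P g ->
  Rintegral Pr setT (fun om => f (X om) * g (Y om)) =
  Rintegral P setT f * Rintegral P setT g.
Proof.
move=> Xl Yl XY sf sg.
have mXY : measurable_fun setT (fun om => (X om, Y om)).
  by apply/measurable_fun_pair; [exact: Xl.1|exact: Yl.1].
pose XY' : {mfun Om >-> (D * D)%type} :=
  HB.pack (fun om => (X om, Y om)) (isMeasurableFun.Build _ _ _ _ _ mXY).
pose h (z : D * D) : \bar R := (f z.1 * g z.2)%:E.
have mh : measurable_fun setT h.
  apply/measurable_EFinP; apply: measurable_funM.
    exact: (measurableT_comp sf.1 measurable_fst).
  exact: (measurableT_comp sg.1 measurable_snd).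
have PE (k : D * D -> \bar R) :
    (\int[P \x P]_z k z = \int[distribution Pr XY']_z k z)%E.
  apply: eq_measure_integral => B mB _.
  by apply: product_measure_unique => // A1 A2 mA1 mA2; exact: XY.
have hi : intble Pr (fun om => f (X om) * g (Y om)).
  by apply: sqintbleM; exact: sqintble_has_law.
have hPi : (P \x P)%E.-integrable setT h.
  apply/integrableP; split => //; rewrite PE ge0_integral_distribution//.
    by move/integrableP : hi => [_].
  exact: measurableT_comp.
rewrite {1}/Rintegral.
have -> : (\int[Pr]_om (f (X om) * g (Y om))%:E = \int[P \x P]_z h z)%E.
  by rewrite PE integral_distribution.
rewrite -integral12_prod_meas1//= /fubini_F/=.
have gi := sqintble_intble sg.
transitivity (Rintegral P setT (fun x => Rintegral P setT g * f x)).
  rewrite /Rintegral; congr fine; apply: eq_integral => x _.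
  rewrite /h/=; under eq_integral do rewrite EFinM.
  rewrite integralZl// muleC EFinM; congr (_ * _)%E.
  by rewrite fineK//; exact: integrable_fin_num.
by rewrite RintegralZl 1?mulrC//; exact: sqintble_intble.
Qed.

End Independence.

Lemma iid_sample_law (R : realType) dO (Om : measurableType dO)
    (Pr : probability Om R) dD (D : measurableType dD) (P : probability D R)
    n (Z : 'I_n -> Om -> D) i : iid_sample Pr P Z -> has_law Pr P (Z i).
Proof. by move=> [mZ ZP _]; split => //; exact: ZP. Qed.

Lemma iid_sample_pair (R : realType) dO (Om : measurableType dO)
    (Pr : probability Om R) dD (D : measurableType dD) (P : probability D R)
    n (Z : 'I_n -> Om -> D) i j (A B : set D) :
  iid_sample Pr P Z -> i != j -> measurable A -> measurable B ->
  Pr (Z i @^-1` A `&` Z j @^-1` B) = (P A * P B)%E.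
Proof.
move=> [mZ ZP ZI] ij mA mB.
(* Pairwise independence is joint independence with the whole space at the other indices. *)
pose C k := if k == i then A else if k == j then B else setT.
have mC k : measurable (C k) by rewrite /C; case: ifP => // _; case: ifP.
have -> : Z i @^-1` A `&` Z j @^-1` B = \bigcap_(k in setT) (Z k @^-1` C k).
  apply/seteqP; split => [om [/= Ai Bj] k _ /=|om /= H].
    by rewrite /C; case: eqP => [->//|_]; case: eqP => [->|].
  split; first by have := H i I; rewrite /C /= eqxx.
  by have := H j I; rewrite /C /= eqxx eq_sym (negPf ij).
rewrite ZI// (bigD1 i)//= (bigD1 j)/= 1?eq_sym//.
rewrite big1 => [|k /andP[ki kj]].
  by rewrite mule1 !ZP// /C !eqxx eq_sym (negPf ij).
by rewrite /C (negPf ki) (negPf kj) preimage_setT probability_setT.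
Qed.

(** * Algebra of the bias and variance terms in terms of [primemx] *)

Section Reduction.
Context {R : realType} {d : nat}.
Implicit Types (A B M N S T : 'M[R]_d) (u v w x : 'cV[R]_d).

Lemma qformM N B v : qform N (B *m v) = qform (B^T *m N *m B) v.
Proof. by rewrite /qform trmx_mul !mulmxA. Qed.

Lemma qform_outer N v x : qform N (x *m x^T *m v) = qform (x *m x^T *m N *m x *m x^T) v.
Proof. by rewrite qformM trmx_mul trmxK !mulmxA. Qed.

Lemma qform_trace N x : qform N x = \tr (N *m (x *m x^T)).
Proof. by rewrite mulmxA mxtrace_mulC mulmxA /mxtrace big_ord1. Qed.

(** Parallelogram identity: the gap between the two sides is the form at [u - v]. *)
Lemma qformD_le N u v : psdmx N ->
  qform N (u + v) <= 2 * qform N u + 2 * qform N v.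
Proof.
move=> Np; rewrite -subr_ge0; have := Np (u - v).
suff -> : qform N (u - v) = 2 * qform N u + 2 * qform N v - qform N (u + v).
  by [].
rewrite !qformE !mulr_sumr -big_split -sumrB/=; apply: eq_bigr => i _.
rewrite !mulr_sumr -big_split -sumrB/=; apply: eq_bigr => j _.
by rewrite !mxE; ring.
Qed.

Section Prime.
Variables (M : 'M[R]_d) (Ms : symmx M) (Mp : pdmx M).

Let sqrt_sym : (sqrtmx M)^T = sqrtmx M.
Proof. by have [] := sqrtmxP Ms (pdmx_psd Mp). Qed.

Let sqrt_unit := sqrtmx_unit Ms Mp.

Let isqrt_sym : (isqrtmx M)^T = isqrtmx M.
Proof. by rewrite /isqrtmx trmx_inv sqrt_sym. Qed.

Lemma qform_primemx N u : qform (primemx M N) u = qform N (isqrtmx M *m u).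
Proof. by rewrite qformM isqrt_sym. Qed.

Lemma sqrtmx_ball w : qform M w <= 1 -> \sum_i ((sqrtmx M *m w) i 0) ^+ 2 <= 1.
Proof. by rewrite qform_sqrtmx//; exact: pdmx_psd. Qed.

(** The substitution of [sqrtmx M *m w] for [w] maps the ellipsoid into the unit ball and turns [N]
    into [primemx M N]. *)
Lemma qform_le_specnorm_prime N w : qform M w <= 1 ->
  qform N w <= specnorm (primemx M N).
Proof.
move=> /sqrtmx_ball /(qform_le_specnorm (primemx M N)).
by rewrite qform_primemx mulmxA mulVmx// mul1mx.
Qed.

Variables (S : 'M[R]_d) (Ss : symmx S) (Sp : pdmx S) (A : 'M[R]_d).

(** The matrix [B] of the outline: the estimator averages [estmx] applied to [y x]. *)
Definition estmx : 'M[R]_d := isqrtmx M *m A *m sqrtmx M *m invmx S.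

Lemma bias_le T w : qform M w <= 1 ->
  qform T (estmx *m S *m w - w) <=
  specnorm ((1%:M - A)^T *m primemx M T *m (1%:M - A)).
Proof.
move=> /sqrtmx_ball; set u := _ *m w => u1.
have -> : estmx *m S *m w - w = (-1) *: (isqrtmx M *m ((1%:M - A) *m u)).
  rewrite /estmx mulmxKV ?pdmx_unit// scaleN1r mulmxBl mul1mx mulmxBr opprB.
  by rewrite /u !mulmxA mulVmx// mul1mx.
rewrite qformZ sqrrN expr1n mul1r -qform_primemx qformM.
exact: qform_le_specnorm.
Qed.

(** The inverse of [primemx M S] is [sqrtmx M *m invmx S *m sqrtmx M]. The leading [S] cancels one
    of the two inverses in the product, and cyclicity of the trace does the rest. *)
Lemma trace_estmx T : symmx T ->
  \tr (S *m (estmx^T *m T *m estmx)) =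
  frob (primemx M T) (A *m invmx (primemx M S) *m A^T).
Proof.
move=> Ts; have Su := pdmx_unit Sp.
have -> : invmx (primemx M S) = sqrtmx M *m invmx S *m sqrtmx M.
  have H : primemx M S *m (sqrtmx M *m invmx S *m sqrtmx M) = 1%:M.
    by rewrite /primemx !mulmxA mulmxKV// mulmxK// mulVmx.
  have Pu : primemx M S \in unitmx by case: (mulmx1_unit H).
  by rewrite -[LHS]mulmx1 -H mulKmx.
have -> : estmx^T = invmx S *m sqrtmx M *m A^T *m isqrtmx M.
  by rewrite /estmx !trmx_mul trmx_inv Ss sqrt_sym isqrt_sym !mulmxA.
rewrite /frob {1}/primemx !trmx_mul isqrt_sym Ts.
rewrite !mulmxA mulmxV// mul1mx.
by rewrite -[X in _ = \tr X]mulmxA [RHS]mxtrace_mulC /estmx !mulmxA.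
Qed.

End Prime.
End Reduction.

(** * Bias-variance decomposition for a shifted sample mean *)

Section SampleMean.
Context {R : realType} {dO dD : measure_display}.
Context {Om : measurableType dO} {D : measurableType dD}.
Variables (Pr : probability Om R) (P : probability D R).
Variables (n : nat) (Z : 'I_n -> Om -> D).
Hypotheses (n_gt0 : (0 < n)%N) (Ziid : iid_sample Pr P Z).

(** One coordinate of the estimation error: [a] is the bias and [f] a centred summand. *)
Let smean a (f : D -> R) om := a + n%:R^-1 * \sum_i f (Z i om).

Lemma sqintble_smean a f : sqintble P f -> sqintble Pr (smean a f).
Proof.
move=> sf; apply: sqintbleD; first exact: sqintble_cst.
apply: sqintbleZ; apply: sqintble_sum => i.
exact: (sqintble_has_law (iid_sample_law i Ziid) sf).
Qed.

(** On expanding, the linear terms vanish by centring and the off-diagonal terms of the double sum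
    by independence. The [n] equal diagonal terms, weighted by the inverse square of [n], leave a
    factor [n%:R^-1]. *)
Lemma Rintegral_smeanM a c f g :
  sqintble P f -> sqintble P g ->
  Rintegral P setT f = 0 -> Rintegral P setT g = 0 ->
  Rintegral Pr setT (fun om => smean a f om * smean c g om) =
  a * c + n%:R^-1 * Rintegral P setT (fun z => f z * g z).
Proof.
move=> sf sg f0 g0.
have law i := iid_sample_law i Ziid.
have sfZ i := sqintble_has_law (law i) sf.
have sgZ i := sqintble_has_law (law i) sg.
have mean0 h : sqintble P h -> Rintegral P setT h = 0 ->
    Rintegral Pr setT (fun om => \sum_i h (Z i om)) = 0.
  move=> sh h0; rewrite RintegralT_sum => [|i].
    rewrite big1// => i _.
    by rewrite (integral_has_law (law i) (sqintble_intble sh)).2.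
  exact/sqintble_intble/sqintble_has_law.
have isum h : sqintble P h -> intble Pr (fun om => \sum_i h (Z i om)).
  by move=> sh; apply: intble_sum => i; exact/sqintble_intble/sqintble_has_law.
have ifg i j : intble Pr (fun om => f (Z i om) * g (Z j om)) by exact: sqintbleM.
have idbl : intble Pr (fun om => \sum_i \sum_j f (Z i om) * g (Z j om)).
  by do 2!apply: intble_sum => ?.
transitivity (Rintegral Pr setT (fun om =>
    (a * c + (a / n%:R) * \sum_j g (Z j om) + (c / n%:R) * \sum_i f (Z i om))
    + n%:R^-1 ^+ 2 * \sum_i \sum_j f (Z i om) * g (Z j om))).
  apply: eq_Rintegral => om _; rewrite /smean -big_distrlr/=; ring.
have i1 : intble Pr (fun om => a * c + (a / n%:R) * \sum_j g (Z j om)).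
  by apply: intbleD; [exact: intble_cst|apply: intbleZ; exact: isum].
have i2 : intble Pr (fun om => (c / n%:R) * \sum_i f (Z i om)).
  by apply: intbleZ; exact: isum.
rewrite RintegralD//; [|exact: intbleD|exact: intbleZ].
rewrite RintegralD// RintegralD//; [|exact: intble_cst|apply: intbleZ; exact: isum].
rewrite RintegralT_cst !RintegralZl//; try exact: isum.
rewrite !mean0// !mulr0 !addr0; congr (_ + _).
rewrite RintegralT_sum; last by move=> i; apply: intble_sum => j.
under eq_bigr do rewrite RintegralT_sum//.
have -> : \sum_(i < n) \sum_(j < n) Rintegral Pr setT (fun om => f (Z i om) * g (Z j om))
    = \sum_(i < n) Rintegral P setT (fun z => f z * g z).
  apply: eq_bigr => i _; rewrite (bigD1 i)//= big1 ?addr0.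
    exact: (integral_has_law (law i) (sqintbleM sf sg)).2.
  move=> j ji; rewrite (Rintegral_indepM (law i) (law j) _ sf sg).
    by rewrite f0 mul0r.
  by move=> B C mB mC; apply: iid_sample_pair => //; rewrite eq_sym.
rewrite sumr_const card_ord -mulr_natl; field.
by rewrite pnatr_eq0 -lt0n.
Qed.

Lemma Rintegral_qform_smean d (N : 'M[R]_d) (b : 'cV[R]_d) (h : D -> 'cV[R]_d) :
  (forall k, sqintble P (fun z => h z k 0)) ->
  (forall k, Rintegral P setT (fun z => h z k 0) = 0) ->
  intble Pr (fun om => qform N (b + n%:R^-1 *: \sum_i h (Z i om))) /\
  Rintegral Pr setT (fun om => qform N (b + n%:R^-1 *: \sum_i h (Z i om))) =
  qform N b + n%:R^-1 * Rintegral P setT (fun z => qform N (h z)).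
Proof.
move=> sh h0.
have E : (fun om => qform N (b + n%:R^-1 *: \sum_i h (Z i om))) =
  (fun om => \sum_k \sum_l N k l * (smean (b k 0) (fun z => h z k 0) om *
                                    smean (b l 0) (fun z => h z l 0) om)).
  apply/funext => om; rewrite qformE; apply: eq_bigr => k _; apply: eq_bigr => l _.
  by rewrite !mxE !summxE.
have i1 k l : intble Pr (fun om => smean (b k 0) (fun z => h z k 0) om *
                                    smean (b l 0) (fun z => h z l 0) om).
  by apply: sqintbleM; exact: sqintble_smean.
rewrite E; split.
  by do 2!apply: intble_sum => ?; exact: intbleZ.
rewrite RintegralT_sum => [|k]; last by apply: intble_sum => l; exact: intbleZ.
under [X in _ + _ * X]eq_Rintegral do rewrite qformE.
rewrite [X in _ + _ * X]RintegralT_sum => [|k]; last first.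
  by apply: intble_sum => l; apply: intbleZ; exact: (sqintbleM (sh k) (sh l)).
rewrite qformE mulr_sumr -big_split/=; apply: eq_bigr => k _.
rewrite !RintegralT_sum => [|l|l]; [|apply: intbleZ; exact: (sqintbleM (sh k) (sh l))|exact: intbleZ].
rewrite mulr_sumr -big_split/=; apply: eq_bigr => l _.
rewrite (RintegralZl _ measurableT (i1 k l)).
rewrite (RintegralZl _ measurableT (sqintbleM (sh k) (sh l))).
by rewrite Rintegral_smeanM//; ring.
Qed.

End SampleMean.

(** * Linear functionals commute with entrywise expectation *)

Section MatrixExpectation.
Context {R : realType} {dD : measure_display} {D : measurableType dD}.
Variable P : probability D R.
Context {d : nat}.

Lemma mexpect_qform (F : D -> 'M[R]_d) v :
  (forall i j, intble P (fun z => F z i j)) ->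
  intble P (fun z => qform (F z) v) /\
  Rintegral P setT (fun z => qform (F z) v) = qform (mexpect P F) v.
Proof.
move=> Fi.
have E : (fun z => qform (F z) v) =
    (fun z => \sum_i \sum_j (v i 0 * v j 0) * F z i j).
  apply/funext => z; rewrite qformE; apply: eq_bigr => i _.
  by apply: eq_bigr => j _; rewrite mulrC.
rewrite E; split; first by do 2!apply: intble_sum => ?; exact: intbleZ.
rewrite RintegralT_sum => [|i]; last by apply: intble_sum => j; exact: intbleZ.
rewrite qformE; apply: eq_bigr => i _.
rewrite RintegralT_sum => [|j]; last exact: intbleZ.
by apply: eq_bigr => j _; rewrite (RintegralZl _ measurableT (Fi i j)) mxE mulrC.
Qed.

Lemma mexpect_trace (K : 'M[R]_d) (F : D -> 'M[R]_d) :
  (forall i j, intble P (fun z => F z i j)) ->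
  intble P (fun z => \tr (K *m F z)) /\
  Rintegral P setT (fun z => \tr (K *m F z)) = \tr (K *m mexpect P F).
Proof.
move=> Fi.
have E : (fun z => \tr (K *m F z)) = (fun z => \sum_i \sum_j K i j * F z j i).
  by apply/funext => z; apply: eq_bigr => i _; rewrite mxE.
rewrite E; split; first by do 2!apply: intble_sum => ?; exact: intbleZ.
rewrite RintegralT_sum => [|i]; last by apply: intble_sum => j; exact: intbleZ.
apply: eq_bigr => i _; rewrite mxE.
rewrite RintegralT_sum => [|j]; last exact: intbleZ.
by apply: eq_bigr => j _; rewrite (RintegralZl _ measurableT (Fi j i)) mxE.
Qed.

End MatrixExpectation.

(** First-order condition at 0 for a quadratic polynomial. Testing at [a / (b + 1)] rather than
    [a / b] covers [b = 0] and gives a negative multiple of [a ^+ 2]. *)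
Lemma linear_term_eq0 (R : realFieldType) (a b : R) : 0 <= b ->
  (forall t, 0 <= t ^+ 2 * b - 2 * t * a) -> a = 0.
Proof.
move=> b0 H; have := H (a / (b + 1)).
have b1 : b + 1 != 0 by rewrite gt_eqF// ltr_wpDl.
have -> : (a / (b + 1)) ^+ 2 * b - 2 * (a / (b + 1)) * a =
    - (a ^+ 2 * ((b + 2) / (b + 1) ^+ 2)) by field.
rewrite oppr_ge0 pmulr_lle0 => [a2|].
  by apply/eqP; rewrite -sqrf_eq0 eq_le a2 sqr_ge0.
by rewrite divr_gt0 ?exprn_gt0// ltr_wpDl.
Qed.

(** * Moments of the source distribution and first-order optimality *)

Section Moments.
Context {R : realType} {d : nat} {dD : measure_display} {D : measurableType dD}.
Variables (P : probability D R) (x : D -> 'cV[R]_d) (y : D -> R).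
Hypothesis xy4 : finite_fourth_moment P x y.

Let mx k : measurable_fun setT (fun z => x z k 0).
Proof. exact: xy4.1. Qed.

Let my : measurable_fun setT y.
Proof. exact: xy4.2.1. Qed.

(** The squared norm of the pair, square integrable by the fourth-moment hypothesis; it dominates
    every monomial of degree two. *)
Let nrm z := \sum_k (x z k 0) ^+ 2 + (y z) ^+ 2.

Let nrm_ge0 z : 0 <= nrm z.
Proof. by rewrite addr_ge0 ?sqr_ge0// sumr_ge0// => k _; exact: sqr_ge0. Qed.

Let x_le_nrm z k : x z k 0 ^+ 2 <= nrm z.
Proof.
rewrite /nrm (bigD1 k)//= -addrA lerDl addr_ge0 ?sqr_ge0//.
by apply: sumr_ge0 => ? _; exact: sqr_ge0.
Qed.

Let y_le_nrm z : y z ^+ 2 <= nrm z.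
Proof. by rewrite lerDr sumr_ge0// => k _; exact: sqr_ge0. Qed.

Let mnrm : measurable_fun setT nrm.
Proof.
apply: measurable_funD; last exact: measurable_funX.
by apply: measurable_sum => k; exact: measurable_funX.
Qed.

Let sqintble_le_nrm (f : D -> R) : measurable_fun setT f -> (forall z, `|f z| <= nrm z) ->
  sqintble P f.
Proof.
move=> mf fn; split => //.
apply: (@le_intble _ _ _ _ _ (fun z => nrm z ^+ 2)).
- exact: measurable_funX.
- by move=> z; rewrite normrX lerXn2r ?nnegrE.
- apply/integrableP; split; first by apply/measurable_EFinP; exact: measurable_funX.
  have [_ [_]] := xy4; apply: le_lt_trans.
  rewrite le_eqVlt; apply/orP; left; apply/eqP; apply: eq_integral => z _.
  by rewrite /= ger0_norm// sqr_ge0.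
Qed.

Lemma sqintble_xx k l : sqintble P (fun z => x z k 0 * x z l 0).
Proof.
apply: sqintble_le_nrm => [|z]; first exact: measurable_funM.
have := x_le_nrm z k; have := x_le_nrm z l.
by rewrite ler_norml => ? ?; apply/andP; split; nra.
Qed.

Lemma sqintble_yx k : sqintble P (fun z => y z * x z k 0).
Proof.
apply: sqintble_le_nrm => [|z]; first exact: measurable_funM.
have := x_le_nrm z k; have := y_le_nrm z.
by rewrite ler_norml => ? ?; apply/andP; split; nra.
Qed.

Lemma sqintble_x k : sqintble P (fun z => x z k 0).
Proof. by split => //; apply: sqintble_intble; exact: sqintble_xx. Qed.

Lemma sqintble_y : sqintble P y.
Proof.
split => //; apply: sqintble_intble; apply: sqintble_le_nrm => [|z].
  exact: measurable_funX.
by rewrite ger0_norm ?sqr_ge0.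
Qed.

Lemma scalar_dotE (w v : 'cV[R]_d) : (w^T *m v) 0 0 = \sum_k w k 0 * v k 0.
Proof. by rewrite mxE; apply: eq_bigr => k _; rewrite mxE. Qed.

Section Residual.
Variable w : 'cV[R]_d.
Let eps z := y z - (w^T *m x z) 0 0.

Lemma sqintble_eps : sqintble P eps.
Proof.
have -> : eps = (fun z => y z + (-1) * \sum_k w k 0 * x z k 0).
  by apply/funext => z; rewrite /eps scalar_dotE mulN1r.
apply: sqintbleD; first exact: sqintble_y.
apply: sqintbleZ; apply: sqintble_sum => k; apply: sqintbleZ; exact: sqintble_x.
Qed.

Lemma sqintble_epsx k : sqintble P (fun z => eps z * x z k 0).
Proof.
have -> : (fun z => eps z * x z k 0) =
    (fun z => y z * x z k 0 + (-1) * \sum_l w l 0 * (x z l 0 * x z k 0)).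
  apply/funext => z; rewrite /eps scalar_dotE mulN1r mulrBl mulr_suml.
  by congr (_ - _); apply: eq_bigr => l _; rewrite mulrA.
apply: sqintbleD; first exact: sqintble_yx.
apply: sqintbleZ; apply: sqintble_sum => l; apply: sqintbleZ; exact: sqintble_xx.
Qed.

(** The risk is finite, so minimality becomes an inequality between reals. *)
Lemma riskE : risk P x y w = (Rintegral P setT (fun z => eps z ^+ 2) / 2)%:E.
Proof.
rewrite /risk -RintegralZr//; last exact: sqintble_eps.2.
rewrite /Rintegral fineK//; apply: integrable_fin_num => //.
have := intbleZ (2^-1) sqintble_eps.2.
by under eq_fun do rewrite mulrC.
Qed.

End Residual.

Lemma residual_orthogonal w k :
  (forall w', (risk P x y w <= risk P x y w')%E) ->
  Rintegral P setT (fun z => (y z - (w^T *m x z) 0 0) * x z k 0) = 0.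
Proof.
move=> wmin; set eps := fun z => y z - (w^T *m x z) 0 0.
have i1 := (sqintble_eps w).2; have i2 := (sqintble_x k).2.
have i3 := sqintble_intble (sqintble_epsx w k).
apply: (@linear_term_eq0 _ _ (Rintegral P setT (fun z => x z k 0 ^+ 2))).
  by apply: Rintegral_ge0 => z _; exact: sqr_ge0.
(* Moving [w] by [t] along coordinate [k] changes twice the risk by a quadratic in [t] whose linear
   coefficient is -2 times the integral sought. *)
move=> t; have := wmin (w + t *: delta_mx k 0).
rewrite !riskE lee_fin ler_pM2r ?invr_gt0// -subr_ge0.
congr (0 <= _).
transitivity (Rintegral P setT (fun z => (eps z ^+ 2 + t ^+ 2 * x z k 0 ^+ 2)
    - 2 * t * (eps z * x z k 0)) - Rintegral P setT (fun z => eps z ^+ 2)).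
  congr (_ - _); apply: eq_Rintegral => z _.
  rewrite linearD mulmxDl mxE linearZ/= -scalemxAl trmx_delta -rowE /eps.
  rewrite [(t *: row k (x z)) 0 0]mxE [row k (x z) 0 0]mxE; ring.
have i4 := intbleZ (t ^+ 2) i2.
rewrite RintegralB//; [|exact: intbleD|exact: intbleZ].
rewrite RintegralD// (RintegralZl _ measurableT i2) (RintegralZl _ measurableT i3).
ring.
Qed.

(** The normal equation: [y] splits into the residual, orthogonal to [x], and its linear part, which
    contributes [S *m w]. *)
Lemma Rintegral_yx S w k : mexpect P (fun z => x z *m (x z)^T) = S ->
  (forall w', (risk P x y w <= risk P x y w')%E) ->
  Rintegral P setT (fun z => y z * x z k 0) = (S *m w) k 0.
Proof.
move=> <- wmin.
transitivity (Rintegral P setT (fun z => (y z - (w^T *m x z) 0 0) * x z k 0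
   + \sum_l w l 0 * (x z k 0 * x z l 0))).
  apply: eq_Rintegral => z _; rewrite scalar_dotE mulrBl mulr_suml.
  rewrite -addrA [X in _ + X](_ : _ = 0) ?addr0// addrC -sumrB big1// => l _; ring.
have i1 l : intble P (fun z => w l 0 * (x z k 0 * x z l 0)).
  by apply: intbleZ; exact: sqintble_intble (sqintble_xx k l).
rewrite RintegralD//; [|exact: sqintble_intble (sqintble_epsx w k)|exact: intble_sum].
rewrite residual_orthogonal// add0r RintegralT_sum// mxE.
apply: eq_bigr => l _.
rewrite (RintegralZl _ measurableT (sqintble_intble (sqintble_xx k l))).
rewrite mulrC; congr (_ * _); rewrite mxE; apply: eq_Rintegral => z _.
by rewrite mxE big_ord1 mxE.
Qed.

Section SecondMoment.
Variables (B T S : 'M[R]_d) (w : 'cV[R]_d) (sigma psi : R).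
Hypotheses (Ts : symmx T) (Tp : psdmx T).
Let eps z := y z - (w^T *m x z) 0 0.
Let K := B^T *m T *m B.

Let Ks : symmx K.
Proof. by rewrite /symmx /K !trmx_mul trmxK Ts mulmxA. Qed.

Let Kp : psdmx K.
Proof. by move=> v; rewrite /K -qformM; exact: Tp. Qed.

Let outerE z k l : (x z *m (x z)^T) k l = x z k 0 * x z l 0.
Proof. by rewrite mxE big_ord1 mxE. Qed.

(** The integrand is the trace of [K] against the noise matrix, and tracing the Loewner bound
    against the positive [K] preserves it. *)
Lemma noise_term_le :
  loewner_le (mexpect P (fun z => eps z ^+ 2 *: (x z *m (x z)^T))) (sigma ^+ 2 *: S) ->
  intble P (fun z => qform T (B *m (eps z *: x z))) /\
  Rintegral P setT (fun z => qform T (B *m (eps z *: x z))) <= sigma ^+ 2 * \tr (S *m K).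
Proof.
move=> noise.
have Fi i j : intble P (fun z => (eps z ^+ 2 *: (x z *m (x z)^T)) i j).
  have := sqintbleM (sqintble_epsx w i) (sqintble_epsx w j).
  by congr intble; apply/funext => z; rewrite [RHS]mxE outerE -/(eps z); ring.
have [i1 e1] := mexpect_trace K Fi.
have E : (fun z => qform T (B *m (eps z *: x z))) =
    (fun z => \tr (K *m (eps z ^+ 2 *: (x z *m (x z)^T)))).
  apply/funext => z; rewrite qformM qformZ qform_trace -/K.
  by rewrite -scalemxAr mxtraceZ.
rewrite E; split => //; rewrite e1.
have := mxtrace_psdM Ks Kp noise.
by rewrite mulmxBr raddfB/= -scalemxAr mxtraceZ (mxtrace_mulC S) subr_ge0.
Qed.

(** The integrand is the form at [w] of the fourth-moment matrix for [A = K]. *)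
Lemma signal_term_le :
  (forall A : 'M[R]_d, symmx A -> psdmx A ->
     loewner_le (mexpect P (fun z => x z *m (x z)^T *m A *m x z *m (x z)^T))
                ((psi * \tr (S *m A)) *: S)) ->
  intble P (fun z => qform T (B *m (x z *m (x z)^T *m w))) /\
  Rintegral P setT (fun z => qform T (B *m (x z *m (x z)^T *m w))) <=
    psi * \tr (S *m K) * qform S w.
Proof.
move=> /(_ K Ks Kp) fourth.
have Fi i j : intble P (fun z => (x z *m (x z)^T *m K *m x z *m (x z)^T) i j).
  (* Each degree-four monomial is paired into two square-integrable products. *)
  have -> : (fun z => (x z *m (x z)^T *m K *m x z *m (x z)^T) i j) =
     (fun z => \sum_b \sum_a K a b * ((x z i 0 * x z a 0) * (x z b 0 * x z j 0))).
    apply/funext => z; rewrite -mulmxA mxE; apply: eq_bigr => b _.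
    rewrite outerE mxE mulr_suml; apply: eq_bigr => a _; rewrite outerE; ring.
  do 2!apply: intble_sum => ?; apply: intbleZ.
  by apply: sqintbleM; exact: sqintble_xx.
have [i1 e1] := mexpect_qform w Fi.
have E : (fun z => qform T (B *m (x z *m (x z)^T *m w))) =
    (fun z => qform (x z *m (x z)^T *m K *m x z *m (x z)^T) w).
  by apply/funext => z; rewrite qformM qform_outer.
rewrite E; split => //; rewrite e1.
rewrite -subr_ge0; have := fourth w; congr (0 <= _).
move: (psi * _) => c; rewrite !qformE mulr_sumr -sumrB; apply: eq_bigr => i _.
by rewrite mulr_sumr -sumrB; apply: eq_bigr => j _; rewrite !mxE; ring.
Qed.

End SecondMoment.
End Moments.

(** * Assembly of the risk bound *)

Section Risk.
Context {R : realType} {d n : nat}.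
Variables (sigma psi : R) (M S T : 'M[R]_d).
Hypotheses (n_gt0 : (0 < n)%N) (psi_ge0 : 0 <= psi).
Hypotheses (Ms : symmx M) (Mp : pdmx M) (Ss : symmx S) (Sp : pdmx S).
Hypotheses (Ts : symmx T) (Tp : psdmx T).

(** Centring at the mean [m] lowers the second moment by exactly [qform T m], which is
    nonnegative. *)
Lemma centered_second_moment_le {dD} {D : measurableType dD}
    (P : probability D R) (g : D -> 'cV[R]_d) (m : 'cV[R]_d) :
  (forall k, sqintble P (fun z => g z k 0)) ->
  (forall k, Rintegral P setT (fun z => g z k 0) = m k 0) ->
  Rintegral P setT (fun z => qform T (g z - m)) <=
  Rintegral P setT (fun z => qform T (g z)).
Proof.
move=> sg gm; have gi k := sqintble_intble (sg k).
have ig : intble P (fun z => qform T (g z)).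
  under eq_fun do rewrite qformE.
  do 2!apply: intble_sum => ?; apply: intbleZ; exact: (sqintbleM (sg _) (sg _)).
have ic k l c : intble P (fun z => T k l * (g z k 0 * m l 0 + m k 0 * g z l 0 - c)).
  apply: intbleZ; apply: intbleB; last exact: intble_cst.
  apply: intbleD; last exact: intbleZ.
  by under eq_fun do rewrite mulrC; exact: intbleZ.
suff -> : Rintegral P setT (fun z => qform T (g z - m)) =
    Rintegral P setT (fun z => qform T (g z)) - qform T m.
  by rewrite gerBl; exact: Tp.
transitivity (Rintegral P setT (fun z => qform T (g z) -
    \sum_k \sum_l T k l * (g z k 0 * m l 0 + m k 0 * g z l 0 - m k 0 * m l 0))).
  apply: eq_Rintegral => z _; rewrite !qformE -sumrB; apply: eq_bigr => k _.
  by rewrite -sumrB; apply: eq_bigr => l _; rewrite !mxE; ring.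
rewrite RintegralB//; last by do 2!apply: intble_sum => ?.
congr (_ - _); rewrite RintegralT_sum => [|k]; last exact: intble_sum.
rewrite qformE; apply: eq_bigr => k _; rewrite RintegralT_sum//.
apply: eq_bigr => l _.
have i1 : intble P (fun z => g z k 0 * m l 0).
  by under eq_fun do rewrite mulrC; exact: intbleZ.
have i2 : intble P (fun z => m k 0 * g z l 0) by exact: intbleZ.
have i3 := intbleD i1 i2.
rewrite (RintegralZl _ measurableT (intbleB i3 (intble_cst P (m k 0 * m l 0)))).
rewrite (RintegralB measurableT i3 (intble_cst P _)) RintegralT_cst.
rewrite (RintegralD measurableT i1 i2).
rewrite (RintegralZr _ measurableT (gi k)) (RintegralZl _ measurableT (gi l)).
by rewrite !gm addrK.
Qed.

Lemma estimator_risk_le (A : 'M[R]_d) (w : 'cV[R]_d)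
    {dP} {DP : measurableType dP} (P : probability DP R) xP yP
    {dQ} {DQ : measurableType dQ} (Q : probability DQ R) xQ yQ
    {dO} {Om : measurableType dO} (Pr : probability Om R) (Z : 'I_n -> Om -> DP) :
  in_class sigma psi M S T w P xP yP Q xQ yQ -> iid_sample Pr P Z ->
  (\int[Pr]_om (qform T (west M S A (fun i => xP (Z i om))
                                    (fun i => yP (Z i om)) - w))%:E
   <= (Jfun n sigma psi M S T A)%:E)%E.
Proof.
move=> [[xy4 _] [ES _] [wM wmin _] noise fourth] Ziid.
pose B := estmx M S A.
pose g z := B *m (yP z *: xP z).
pose m := B *m S *m w.
have gE z k : g z k 0 = \sum_l B k l * (yP z * xP z l 0).
  by rewrite mxE; apply: eq_bigr => l _; rewrite [(yP z *: xP z) l 0]mxE.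
have sg k : sqintble P (fun z => g z k 0).
  under eq_fun do rewrite gE.
  by apply: sqintble_sum => l; apply: sqintbleZ; exact: sqintble_yx.
have gm k : Rintegral P setT (fun z => g z k 0) = m k 0.
  under eq_Rintegral do rewrite gE.
  have iyx l := sqintble_intble (sqintble_yx xy4 l).
  rewrite RintegralT_sum => [|l]; last exact: intbleZ.
  rewrite /m -mulmxA mxE; apply: eq_bigr => l _.
  by rewrite (RintegralZl _ measurableT (iyx l)) (Rintegral_yx xy4 l ES wmin).
pose h z := g z - m.
have hE z k : h z k 0 = g z k 0 - m k 0.
  by rewrite /h [(g z - m) k 0]mxE [(- m) k 0]mxE.
have sh k : sqintble P (fun z => h z k 0).
  under eq_fun do rewrite hE.
  apply: sqintbleD; last exact: sqintble_cst.
  exact: sg.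
have h0 k : Rintegral P setT (fun z => h z k 0) = 0.
  transitivity (Rintegral P setT (fun z => g z k 0 - m k 0)).
    by apply: eq_Rintegral => z _; rewrite hE.
  rewrite (RintegralB measurableT (sqintble_intble (sg k)) (intble_cst P _)).
  by rewrite RintegralT_cst gm subrr.
have n0 : n%:R != 0 :> R by rewrite pnatr_eq0 -lt0n.
(* Deterministic bias plus an average of centred terms; [n%:R != 0] lets the average of the constant
   [m] be [m]. *)
have westE om : west M S A (fun i => xP (Z i om)) (fun i => yP (Z i om)) - w =
    (m - w) + n%:R^-1 *: \sum_i h (Z i om).
  rewrite /west -/(estmx M S A) -/B mulmx_sumr sumrB sumr_const card_ord.
  by rewrite scalerBr -[m *+ n]scaler_nat scalerA mulVf// scale1r [RHS]addrC addrA subrK.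
have [i1 e1] := Rintegral_qform_smean n_gt0 Ziid T (m - w) sh h0.
under eq_integral do rewrite westE.
rewrite -[leLHS]fineK; last exact: integrable_fin_num.
rewrite lee_fin [leLHS]e1 /Jfun lerD ?bias_le//.
rewrite mulrAC [leRHS]mulrC ler_pM2l ?invr_gt0 ?ltr0n//.
apply: le_trans (centered_second_moment_le sg gm) _.
have [ni nle] := noise_term_le xy4 B Ts Tp noise.
have [si sle] := signal_term_le xy4 B w Ts Tp fourth.
set eps := fun z => yP z - (w^T *m xP z) 0 0.
(* Signal plus noise; bounding the form of the sum produces the factors 2 of [Jfun]. *)
have gD z : g z = B *m (xP z *m (xP z)^T *m w) + B *m (eps z *: xP z).
  rewrite /g -mulmxDr; congr (_ *m _); apply/colP => k.
  rewrite -mulmxA [(xP z)^T *m w]mx11_scalar mul_mx_scalar.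
  have -> : ((xP z)^T *m w) 0 0 = (w^T *m xP z) 0 0.
    by rewrite !mxE; apply: eq_bigr => l _; rewrite !mxE mulrC.
  by rewrite -scalerDl /eps addrC subrK.
apply: (@le_trans _ _ (Rintegral P setT (fun z =>
    2 * qform T (B *m (xP z *m (xP z)^T *m w)) +
    2 * qform T (B *m (eps z *: xP z))))).
  apply: le_Rintegral => //; last by move=> z _; rewrite gD; exact: qformD_le.
    under eq_fun do rewrite qformE.
    do 2!apply: intble_sum => ?; apply: intbleZ; exact: (sqintbleM (sg _) (sg _)).
  by apply: intbleD; exact: intbleZ.
rewrite (RintegralD measurableT (intbleZ 2 si) (intbleZ 2 ni)).
rewrite (RintegralZl _ measurableT si) (RintegralZl _ measurableT ni).
rewrite -trace_estmx//.
have t0 : 0 <= \tr (S *m (B^T *m T *m B)).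
  apply: mxtrace_psdM => //; first exact: pdmx_psd.
  by move=> v; rewrite -qformM; exact: Tp.
have wS := qform_le_specnorm_prime Ms Mp S wM.
(* Replaces [qform S w] in the signal bound by the spectral norm, as its coefficient is nonnegative;
   the rest is linear. *)
have := ler_wpM2l (mulr_ge0 psi_ge0 t0) wS.
move: nle sle; rewrite -/B -/eps; lra.
Qed.

End Risk.

Theorem theorem2 (R : realType) (d n : nat) (sigma psi : R)
    (M S T : 'M[R]_d) :
  (0 < d)%N -> (0 < n)%N -> 0 < sigma -> 1 <= psi ->
  symmx M -> pdmx M -> symmx S -> pdmx S -> symmx T -> psdmx T ->
  (forall A : 'M[R]_d,
     (worst_risk n sigma psi M S T A <= (Jfun n sigma psi M S T A)%:E)%E) /\
  (forall Astar : 'M[R]_d,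
     (forall A : 'M[R]_d, Jfun n sigma psi M S T Astar <= Jfun n sigma psi M S T A) ->
     (worst_risk n sigma psi M S T Astar <=
        (inf [set Jfun n sigma psi M S T A | A in [set: 'M[R]_d]])%:E)%E).
Proof.
move=> _ n_gt0 _ psi1 Ms Mp Ss Sp Ts Tp.
have risk_le A : (worst_risk n sigma psi M S T A <= (Jfun n sigma psi M S T A)%:E)%E.
  apply: ge_ereal_sup => e.
  move=> [dP [dQ [dO [DP [DQ [Om [P [xP [yP [Q [xQ [yQ [w [Pr [Z]]]]]]]]]]]]]]].
  move=> [cls iid ->].
  exact: (estimator_risk_le n_gt0 (le_trans ler01 psi1) Ms Mp Ss Sp Ts Tp A cls iid).
split => // Astar Amin; apply: le_trans (risk_le Astar) _.
(* By minimality the value at [Astar] is a lower bound of a nonempty set, hence at most its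
   infimum. *)
rewrite lee_fin; apply: lb_le_inf; first by exists (Jfun n sigma psi M S T Astar), Astar.
by move=> _ [A _ <-]; exact: Amin.
Qed.
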